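(* Let $D$ be a digraph and $U = \{u_j\}_{j \in [m]} \subseteq V(D)$. Then the detour $D \uparrow U := ( \dots (D \uparrow u_1) \dots \uparrow u_{m-1}) \uparrow u_m$ and the bypass $D \upuparrows U := (D \uparrow U) - U$ are well-defined, i.e., they do not depend on the order in which the elements of $U$ are enumerated.
   Context: Digraphs are finite and loopless, with no parallel arcs; $V(D)$ is the vertex set and $\mu_D : V(D)^2 \to \{0,1\}$ the adjacency matrix ($\mu_D(x,y)=1$ iff $(x,y)$ is an arc). $[m] = \{1,\dots,m\}$. For $v \in V(D)$ let $P(D)_v := \{x \in V(D)\setminus\{v\} : \mu_D(x,v) \neq 0\}$ (predecessors) and $S(D)_v := \{x \in V(D) \setminus \{v\} : \mu_D(v,x) \ne 0\}$ (successors). The detour $D \uparrow v$ is the digraph with $V(D \uparrow v) := V(D)$ and $$\mu_{D \uparrow v}(x,y) := \begin{cases} 0 & \text{if } (x,y) \in [P(D)_v \times \{v\}] \cup [\{v\} \times S(D)_v]; \\ 1 & \text{if } (x,y) \in P(D)_v \times S(D)_v \text{ and } x \neq y; \\ \mu_D(x,y) & \text{otherwise.}\end{cases}$$ For a digraph $H$ and $U \subseteq V(H)$, $H - U$ denotes the digraph obtained by deleting the vertices in $U$. *)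

(* Defs.v *)
From mathcomp Require Import all_boot.

Set Implicit Arguments.
Unset Strict Implicit.
Unset Printing Implicit Defensive.

(* The vertex set is a subset of an ambient finite type, so that a digraph and
   its vertex deletions have the same type and can be compared with [=].  The
   adjacency matrix is extended by [false] outside V(D) x V(D), and finite
   functions make [=] extensional; see [digraph_eqP]. *)
Definition digraph_axiom (T : finType) (V : {set T})
    (mu : {ffun T * T -> bool}) : bool :=
  [forall x, ~~ mu (x, x)] &&
  [forall x, forall y, mu (x, y) ==> (x \in V) && (y \in V)].

Record digraph (T : finType) : Type := Digraph {
  vset : {set T};
  adj : {ffun T * T -> bool};
  digraphP : digraph_axiom vset adj
}.

Definition mu (T : finType) (D : digraph T) (x y : T) : bool := adj D (x, y).

Section Digraphs.
Variable T : finType.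
Implicit Types (D H : digraph T) (U : {set T}) (x y v : T) (s : seq T).

Lemma mu_irr D x : mu D x x = false.
Proof. by case/andP: (digraphP D) => /forallP/(_ x)/negbTE. Qed.

Lemma mu_vset D x y : mu D x y -> (x \in vset D) && (y \in vset D).
Proof. by case/andP: (digraphP D) => _ /forallP/(_ x)/forallP/(_ y)/implyP. Qed.

Lemma digraph_eqP D H : D = H <-> vset D = vset H /\ mu D =2 mu H.
Proof.
split=> [-> // | ].
case: D H => [V m Dm] [V' m' Hm] [/= eqV eqm].
have {eqm} em : m = m' by apply/ffunP=> -[x y]; apply: eqm.
case: _ / eqV Hm; case: _ / em => Hm.
by congr Digraph; apply: bool_irrelevance.
Qed.

Definition predecessors D v : {set T} := [set x in vset D :\ v | mu D x v].

Definition successors D v : {set T} := [set x in vset D :\ v | mu D v x].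

Definition detour_adj D v : {ffun T * T -> bool} :=
  [ffun p : T * T =>
    if p \in setX (predecessors D v) [set v] :|: setX [set v] (successors D v)
    then false
    else if (p \in setX (predecessors D v) (successors D v)) && (p.1 != p.2)
    then true
    else mu D p.1 p.2].

Lemma detour_subproof D v : digraph_axiom (vset D) (detour_adj D v).
Proof.
apply/andP; split.
  apply/forallP=> x; rewrite ffunE /= eqxx andbF mu_irr.
  by case: ifP.
apply/forallP=> x; apply/forallP=> y; apply/implyP; rewrite ffunE /=.
case: ifP => // _; case: ifP => [|_]; last exact: mu_vset.
by rewrite !inE => /andP[/andP[/andP[/andP[_ ->] _] /andP[/andP[_ ->] _]] _].
Qed.

Definition detour D v : digraph T := Digraph (detour_subproof D v).

Definition delete_adj D U : {ffun T * T -> bool} :=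
  [ffun p : T * T => [&& p.1 \notin U, p.2 \notin U & mu D p.1 p.2]].

Lemma delete_subproof D U : digraph_axiom (vset D :\: U) (delete_adj D U).
Proof.
apply/andP; split; first by apply/forallP=> x; rewrite ffunE /= mu_irr !andbF.
apply/forallP=> x; apply/forallP=> y; apply/implyP; rewrite ffunE /= !inE.
by case/and3P=> -> -> /mu_vset.
Qed.

Definition delete D U : digraph T := Digraph (delete_subproof D U).

Definition enumerates s U : Prop := uniq s /\ s =i U.

(* [detours D [:: u_1; ...; u_m]] is (...(D detour u_1)...) detour u_m. *)
Definition detours D s : digraph T := foldl detour D s.

Definition bypass D s : digraph T := delete (detours D s) [set x in s].

End Digraphs.

(* Main.v *)
Require Import Defs.
From mathcomp Require Import all_boot.

(** After the detours at [u] and [v], in either order, [x -> y] is an arc iff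
    [x] and [y] are distinct, lie outside [{u, v}], and are joined in [D] by a
    path with interior in [{u, v}].  This condition is symmetric in [u] and
    [v], so detours commute. *)

Lemma mu_detour (T : finType) (D : digraph T) (v x y : T) :
  mu (detour D v) x y =
    [&& x != y, x != v, y != v & mu D x y || mu D x v && mu D v y].
Proof.
rewrite {1}/mu ffunE /= !inE /=.
have [->|xy] := eqVneq x y; first by rewrite mu_irr andbF !if_same.
have [->|xv] := eqVneq x v.
  (* No arc leaves [v] in the detour: an arc [v -> y] of [D] makes [y] a successor, so the first
     clause of [detour_adj] removes it. *)
  rewrite mu_irr; case Evy: (mu D v y); last by rewrite !andbF.
  have /andP[_ ->] := mu_vset Evy.
  by case: eqVneq Evy => // ->; rewrite mu_irr.
have [->|yv] := eqVneq y v.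
  rewrite mu_irr; case Exv: (mu D x v); last by rewrite !andbF.
  by have /andP[-> _] := mu_vset Exv.
rewrite !andbF /= andbT.
case Exv: (mu D x v); case Evy: (mu D v y);
  rewrite ?andbF ?orbF //= !andbT orbT.
have /andP[-> _] := mu_vset Exv.
by have /andP[_ ->] := mu_vset Evy.
Qed.

Lemma detourC (T : finType) (D : digraph T) (u v : T) :
  detour (detour D u) v = detour (detour D v) u.
Proof.
apply/digraph_eqP; split=> // x y; rewrite !mu_detour.
rewrite (eq_sym v u) (eq_sym v y) (eq_sym u y).
have [->|uv] := eqVneq u v; first by [].
case: (x != y); case: (x != u); case: (y != u); case: (x != v);
  case: (y != v); rewrite //= ?andbF //=.
(* Both sides now ask for the arc [x -> y] or a path from [x] to [y] through [u], [v] or both. The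
   extra walks x-u-v-u-y and x-v-u-v-y are absorbed by x-u-y and x-v-y. *)
by case: (mu D x y); case: (mu D x u); case: (mu D x v); case: (mu D u y);
  case: (mu D v y); case: (mu D u v); case: (mu D v u).
Qed.

Lemma detours_detour (T : finType) (D : digraph T) (v : T) (s : seq T) :
  detours (detour D v) s = detour (detours D s) v.
Proof. by elim: s D => //= u s IHs D; rewrite detourC IHs. Qed.

Lemma detoursC (T : finType) (D : digraph T) (s t : seq T) :
  detours (detours D s) t = detours (detours D t) s.
Proof. by elim: s D => //= u s IHs D; rewrite IHs detours_detour. Qed.

Lemma perm_detours (T : finType) (D : digraph T) (s t : seq T) :
  perm_eq s t -> detours D s = detours D t.
Proof.
(* Exchanges of two leading blocks generate all permutations; the detours along [s3] then start from
   equal digraphs. *)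
apply: catCA_perm_subst => s1 s2 s3.
rewrite /detours !foldl_cat; congr foldl; exact: detoursC.
Qed.

Theorem mainTheorem5 (T : finType) (D : digraph T) (U : {set T})
    (hU : U \subset vset D) (s t : seq T)
    (hs : enumerates s U) (ht : enumerates t U) :
  detours D s = detours D t /\ bypass D s = bypass D t.
Proof.
case: hs ht => [us es] [ut et].
have st : s =i t by move=> x; rewrite es et.
have e : detours D s = detours D t by apply/perm_detours/uniq_perm.
split=> //; rewrite /bypass e; congr delete.
by apply/setP=> x; rewrite !inE st.
Qed.
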